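(* Let $X$ be a Banach space. Norm-one complemented subspaces of $X$ inherit each of the properties CWO, CWO-$B$, and CWO-$S$. That is, if $Y$ is a subspace of $X$ which is the range of a linear projection $P:X\to X$ with $\|P\|=1$, then: if $X$ has property CWO, so does $Y$; if $X$ has property CWO-$B$, so does $Y$; and if $X$ has property CWO-$S$, so does $Y$.
   Context: Banach spaces are over the scalar field $\mathbb K$, where $\mathbb K=\mathbb R$ or $\mathbb K=\mathbb C$. $B_X$, $B_X^\circ$ and $S_X$ denote the closed unit ball, the open unit ball and the unit sphere of a Banach space $X$. A finite convex combination of relatively weakly open subsets of $B_X$ is a set $C=\sum_{j=1}^n\lambda_jU_j=\{\sum_{j=1}^n\lambda_ju_j: u_j\in U_j\}$, where $n\in\mathbb N$, each $U_j\subset B_X$ is open in the relative weak topology of $B_X$, $\lambda_j>0$ and $\sum_{j=1}^n\lambda_j=1$. The space $X$ has property CWO if every such $C$ is open in the relative weak topology of $B_X$; property CWO-$S$ if, for every such $C$, every $x\in C\cap S_X$ is an interior point of $C$ in the relative weak topology of $B_X$; and property CWO-$B$ if, for every such $C$, every $x\in C\cap B_X^\circ$ is an interior point of $C$ in the relative weak topology of $B_X$. *)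

(* Defs.v *)
From HB Require Import structures.
From mathcomp Require Import all_boot all_order all_algebra.
From mathcomp Require Import complex.
From mathcomp Require Import all_classical all_reals all_analysis.

Set Implicit Arguments.
Unset Strict Implicit.
Unset Printing Implicit Defensive.

Import Order.TTheory GRing.Theory Num.Theory.
Import numFieldNormedType.Exports.

Local Open Scope classical_set_scope.
Local Open Scope ring_scope.

Variant scalar_kind := RealScalars | ComplexScalars.

(* In [R[i]] (as in any [numFieldType]), [0 < z] means that [z] is a positive
   real number, and the norm of a space over [R[i]] takes its values among the
   nonnegative reals of [R[i]]. *)
Definition scalars (R : realType) (k : scalar_kind) : numFieldType :=
  match k with
  | RealScalars => R
  | ComplexScalars => R[i]
  end.

Section CWO.
Context {K : numFieldType} (X : normedModType K).

Definition dual := {f : {linear X -> K^o} | continuous f}.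

Definition weak_space : topologicalType :=
  sup_topology (fun f : dual =>
    Topological.class (initial_topology (sval f : X -> K^o))).

Definition unit_ball : set X := [set x | `|x| <= 1].
Definition open_unit_ball : set X := [set x | `|x| < 1].
Definition unit_sphere : set X := [set x | `|x| = 1].

Definition ball_weak_open (U : set X) :=
  exists2 V : set X, @open weak_space V & U = unit_ball `&` V.

Definition ball_weak_interior (C : set X) : set X :=
  [set x | exists U, [/\ ball_weak_open U, U x & U `<=` C]].

Definition convex_combination n (lambda : 'I_n -> K) (U : 'I_n -> set X) :
    set X :=
  [set x | exists2 u : 'I_n -> X,
    (forall j, U j (u j)) & x = \sum_(j < n) lambda j *: u j].

Definition cc_weak_open (C : set X) :=
  exists n (lambda : 'I_n -> K) (U : 'I_n -> set X),
    [/\ forall j, ball_weak_open (U j), forall j, 0 < lambda j,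
        \sum_(j < n) lambda j = 1 & C = convex_combination lambda U].

Definition CWO := forall C, cc_weak_open C -> ball_weak_open C.

Definition CWO_S := forall C, cc_weak_open C ->
  C `&` unit_sphere `<=` ball_weak_interior C.

Definition CWO_B := forall C, cc_weak_open C ->
  C `&` open_unit_ball `<=` ball_weak_interior C.

(* The supremum is [0] when the set is unbounded, so [opnorm P = 1] entails
   that [P] is bounded. *)
Definition opnorm (P : {linear X -> X}) : K :=
  supremum 0 [set `|P x| | x in unit_ball].

End CWO.

Section subspace.
Context {K : numFieldType} {X : normedModType K} (Y : submodClosed X).

Definition subspace_of := {x : X | x \in Y}.

HB.instance Definition _ := SubChoice.on subspace_of.
HB.instance Definition _ := [SubChoice_isSubLmodule of subspace_of by <:].

Let subnorm (y : subspace_of) : K := `|val y|.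

Let ler_subnormD x y : subnorm (x + y) <= subnorm x + subnorm y.
Proof. exact: ler_normD. Qed.

Let subnormZ (l : K) x : subnorm (l *: x) = `|l| * subnorm x.
Proof. exact: normrZ. Qed.

Let subnorm0_eq0 x : subnorm x = 0 -> x = 0.
Proof. by move=> /normr0_eq0 x0; apply: val_inj; rewrite x0 raddf0. Qed.

HB.instance Definition _ := Lmodule_isNormed.Build K subspace_of
  ler_subnormD subnormZ subnorm0_eq0.

Lemma subspace_normE (y : subspace_of) : `|y| = `|val y|.
Proof. by []. Qed.

End subspace.

(* Main.v *)
From HB Require Import structures.
Require Import Defs.
From mathcomp Require Import all_boot all_order all_algebra.
From mathcomp Require Import all_classical all_reals all_analysis.

Set Implicit Arguments.
Unset Strict Implicit.
Unset Printing Implicit Defensive.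

(** A norm-one projection with range [Y] presents [Y] as a retract of [X] by
    norm-nonincreasing linear maps: the inclusion [i : Y -> X] and the
    corestriction [p : X -> Y] satisfy [p \o i = id].  The three properties
    descend along any such retract, whatever the spaces.

    Both maps are continuous for the weak topologies and send the unit ball into
    the unit ball, so the preimage of a relatively weakly open set under either
    map, cut down to the unit ball, is again relatively weakly open
    ([ball_weak_open_preimage]).  Given a convex
    combination [C = \sum_j lambda_j U_j] in the ball of [Y], the sets
    [W_j = B_X `&` p^-1(U_j)] are relatively weakly open in the ball of [X]; put
    [D = \sum_j lambda_j W_j].  Applying [i] to a decomposition of a point of [C]
    shows [i(C) `<=` D], and applying [p] to a decomposition of [i y] in [D] shows
    [y \in C]; hence [C = i^-1(D)] ([cc_weak_open_lift]).  The preimage under [i]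
    therefore turns weak openness of [D], or weak interior points of [D], into the
    same for [C].  Since [i] is isometric, it also respects the unit sphere and
    the open unit ball, which settles all three properties at once. *)

Local Open Scope ring_scope.

Import Order.TTheory GRing.Theory Num.Theory.
Import numFieldNormedType.Exports.
Local Open Scope classical_set_scope.

Lemma dual_weak_continuous (K : numFieldType) (X : normedModType K)
    (f : dual X) : continuous (sval f : weak_space X -> K^o).
Proof.
apply/continuousP => A oA; rewrite openE => x Ax.
have /(_ _ f) := (@cvg_sup X _ _ (nbhs (x : weak_space X)) x _).1 (@cvg_id _ _).
apply; apply: open_nbhs_nbhs; split; last exact: Ax.
by exists A.
Qed.

(** Composing with [T] pulls the functionals that define the weak topology of
    [Y] back to functionals on [X]. *)
Lemma linear_weak_continuous (K : numFieldType) (X Y : normedModType K)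
    (T : {linear X -> Y}) :
  continuous T -> continuous (T : weak_space X -> weak_space Y).
Proof.
move=> cT x; apply/cvg_sup.
  exact: (@fmap_filter _ _ T _ (@nbhs_filter (weak_space X) x)).
move=> [g cg].
have cgT : continuous (g \o T : X -> K^o).
  by move=> z; apply: continuous_comp; [exact: cT|exact: cg].
apply: (@continuous_comp_initial Y (weak_space X) K^o g T _ x).
pose gT : dual X := exist _ (g \o T : {linear X -> K^o}) cgT.
exact: (@dual_weak_continuous _ _ gT).
Qed.

Section nonexpansive.
Context {K : numFieldType} {X Y : normedModType K}.

Definition nonexpansive (T : X -> Y) := forall x, `|T x| <= `|x|.

Lemma nonexpansive_linear_continuous (T : {linear X -> Y}) :
  nonexpansive T -> continuous T.
Proof.
move=> Tle; apply/linear_bounded_continuous/linear_boundedP.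
exists 1; split=> // r r1 x.
by rewrite (le_trans (Tle x))// ler_peMl// ltW.
Qed.

(** The preimage of a subset of the ball of [Y] may leave the ball of [X], hence
    the intersection; on the ball of [X] the condition that [T x] lies in the
    ball of [Y] holds because [T] does not increase norms. *)
Lemma ball_weak_open_preimage (T : {linear X -> Y}) (U : set Y) :
  nonexpansive T -> ball_weak_open U ->
  ball_weak_open (@unit_ball K X `&` T @^-1` U).
Proof.
move=> Tle [V oV ->]; exists (T @^-1` V).
  have /linear_weak_continuous/continuousP := nonexpansive_linear_continuous Tle.
  exact.
rewrite preimage_setI setIA; congr (_ `&` _).
by apply/setIidPl => x; exact: le_trans (Tle x).
Qed.

End nonexpansive.

Lemma ball_weak_open_sub (K : numFieldType) (X : normedModType K) (U : set X) :
  ball_weak_open U -> U `<=` @unit_ball K X.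
Proof. by case=> V _ -> x []. Qed.

Section retract.
Context {K : numFieldType} {X Y : normedModType K}.
Variables (i : {linear Y -> X}) (p : {linear X -> Y}).
Hypotheses (ile : nonexpansive i) (ple : nonexpansive p) (iK : cancel i p).

Lemma retract_norm y : `|i y| = `|y|.
Proof. by apply/eqP; rewrite eq_le ile/= -{1}(iK y) ple. Qed.

(** The heart of the argument: [D] is built from the preimages under [p] of the
    pieces of [C], with the same coefficients. *)
Lemma cc_weak_open_lift (C : set Y) : cc_weak_open C ->
  exists2 D : set X, cc_weak_open D & i @^-1` D = C.
Proof.
move=> [n [lambda [U [oU lambda_gt0 lambda1 ->]]]].
pose W j := @unit_ball K X `&` p @^-1` U j.
exists (convex_combination lambda W).
  exists n, lambda, W; split=> // j.
  exact: ball_weak_open_preimage.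
apply/seteqP; split=> y /= [u Uu yE].
- exists (p \o u) => [j|]; first by case: (Uu j).
  rewrite -[y]iK yE linear_sum.
  by apply: eq_bigr => j _; rewrite linearZ.
- exists (i \o u) => [j|].
    split; last by rewrite /= iK.
    by rewrite /unit_ball /= retract_norm; exact: (ball_weak_open_sub (oU j)).
  rewrite yE linear_sum.
  by apply: eq_bigr => j _; rewrite linearZ.
Qed.

(** As [D] lies in the ball of [X] and [i] is isometric, the preimage stays in
    the ball of [Y]. *)
Lemma ball_weak_open_restrict (D : set X) :
  ball_weak_open D -> ball_weak_open (i @^-1` D).
Proof.
move=> oD; rewrite -(_ : @unit_ball K Y `&` i @^-1` D = i @^-1` D).
  exact: ball_weak_open_preimage ile oD.
apply/setIidPr => y /= /(ball_weak_open_sub oD).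
by rewrite /unit_ball /= retract_norm.
Qed.

Lemma ball_weak_interior_restrict (D : set X) (y : Y) :
  ball_weak_interior D (i y) -> ball_weak_interior (i @^-1` D) y.
Proof.
move=> [U [oU Uy UD]]; exists (i @^-1` U); split=> //.
  exact: ball_weak_open_restrict.
by move=> z; exact: UD.
Qed.

Lemma CWO_retract : CWO X -> CWO Y.
Proof.
move=> cwoX C /cc_weak_open_lift[D /cwoX oD <-].
exact: ball_weak_open_restrict.
Qed.

Lemma CWO_B_retract : CWO_B X -> CWO_B Y.
Proof.
move=> cwoX C /cc_weak_open_lift[D /cwoX DB <-] y [Dy y1].
apply: ball_weak_interior_restrict; apply: DB; split=> //.
by rewrite /open_unit_ball /= retract_norm.
Qed.

Lemma CWO_S_retract : CWO_S X -> CWO_S Y.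
Proof.
move=> cwoX C /cc_weak_open_lift[D /cwoX DS <-] y [Dy y1].
apply: ball_weak_interior_restrict; apply: DS; split=> //.
by rewrite /unit_sphere /= retract_norm.
Qed.

End retract.

(** A nonzero value of the supremum cannot be its default [0], so [1] is a genuine
    least upper bound of the norms of [P x] over the unit ball; homogeneity
    extends the bound to the whole space. *)
Lemma opnorm1_nonexpansive (K : numFieldType) (X : normedModType K)
    (P : {linear X -> X}) : opnorm P = 1 -> nonexpansive P.
Proof.
rewrite /opnorm /supremum; case: ifPn => [_ /esym/eqP|_].
  by rewrite oner_eq0.
case: xgetP => [s -> [ubs _] s1|_ /esym/eqP]; last by rewrite oner_eq0.
move=> x; have [->|x0] := eqVneq x 0; first by rewrite linear0.
have x_gt0 : 0 < `|x| by rewrite normr_gt0.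
have : `|P (`|x|^-1 *: x)| <= 1.
  rewrite -s1; apply: ubs; exists (`|x|^-1 *: x) => //=.
  by rewrite /unit_ball /= normrZ normfV normr_id mulVf// gt_eqF.
by rewrite linearZ normrZ normfV normr_id mulrC ler_pdivrMr// mul1r.
Qed.

Section projection.
Context {K : numFieldType} {X : normedModType K} (Y : submodClosed X).
Variables (P : {linear X -> X}) (PY : forall x, P x \in Y).

Definition corestrict (x : X) : subspace_of Y := exist _ (P x) (PY x).

Fact corestrict_is_linear : linear corestrict.
Proof. by move=> a x y; apply: val_inj; rewrite /= linearP. Qed.

HB.instance Definition _ :=
  GRing.isLinear.Build K X (subspace_of Y) _ corestrict corestrict_is_linear.

End projection.

Theorem proposition4p3 (R : realType) (k : scalar_kind)
    (X : completeNormedModType (scalars R k))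
    (Y : submodClosed X) (P : {linear X -> X}) :
  (forall x, P (P x) = P x) ->
  opnorm P = 1 ->
  (forall y, y \in Y <-> exists x, P x = y) ->
  [/\ CWO X -> CWO (subspace_of Y),
      CWO_B X -> CWO_B (subspace_of Y) &
      CWO_S X -> CWO_S (subspace_of Y)].
Proof.
move=> PP /opnorm1_nonexpansive Ple YP.
have PY x : P x \in Y by apply/YP; exists x.
pose i : {linear subspace_of Y -> X} := val.
pose p : {linear X -> subspace_of Y} := corestrict PY.
have ile : nonexpansive i by move=> y; rewrite subspace_normE.
have ple : nonexpansive p by move=> x; rewrite subspace_normE; exact: Ple.
have iK : cancel i p.
  move=> y; apply: val_inj => /=.
  by have /YP[x <-] := valP y; exact: PP.
split; [exact: CWO_retract iK|exact: CWO_B_retract iK|exact: CWO_S_retract iK].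
Qed.
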